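(* Let the spaces $\mathbb{X},\mathbb{Y}$, the operator $K$, the noise $n$, the singular value decomposition $\{(\sigma_l,\varphi_l,\psi_l):l\in\mathbb{N}\}$ and the notions of estimator and risk be as described in the context. Consider a sequence $(a_l)_{l\in\mathbb{N}}$ such that $a_l>0$ and $\lim_{l\to\infty}a_l=\infty$, and an ellipsoid of the form $$\Theta=\Big\{v\in\mathbb{X}:\ \sum_{l=1}^\infty a_l^2 v_l^2\le Q\Big\},\qquad v_l:=\langle v,\varphi_l\rangle_{\mathbb{X}},$$ with $Q>0$. Then there exists a unique minimax linear estimator on $\Theta$. It is of the diagonal form $$W_{\overline\lambda}\tau=\sum_{l\in\mathbb{N}}\frac{\overline\lambda_l}{\sigma_l}\,\langle \mathrm{Cov}[n]^{-1/2}\tau,\psi_l\rangle_{\mathbb{Y}}\,\varphi_l ,$$ and its weights are given by $$\overline\lambda_l=\max(1-\overline\kappa a_l,0),$$ where the constant $\overline\kappa>0$ is the unique solution of the equation (in the unknown $\kappa$) $$\kappa Q-\sum_{l=1}^\infty\frac{a_l}{\sigma_l^2}\max(1-\kappa a_l,0)=0.$$ The minimax linear risk is given by $$R^L(\Theta)=\sum_{l=1}^\infty\frac{1}{\sigma_l^2}\max(1-\overline\kappa a_l,0).$$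
   Context: Setting. Let $N_z,N_a$ be positive integers, $\mathbb{X}=L^2([-\pi,\pi]^2)^{3N_z}$ and $\mathbb{Y}=L^2([-\pi,\pi]^2)^{N_a}$. The data $\tau\in\mathbb{Y}$ and the unknown $v\in\mathbb{X}$ are related by $\tau=Kv+n$, where $K:\mathbb{X}\to\mathbb{Y}$ is a compact linear operator given by a matrix of (periodic) convolution operators, i.e. each of the $N_a$ components of $Kv$ is a sum of periodic convolutions of the $3N_z$ components of $v$ with given kernels. The noise $n$ is a Hilbert space process in $\mathbb{Y}$ with zero mean value and known covariance operator $\mathrm{Cov}[n]$, which is assumed to be strictly positive definite, i.e. every linear functional of $\tau$ contains a minimal fixed amount of noise. Whitening and diagonalization. The operator $\tilde K:=\mathrm{Cov}[n]^{-1/2}K$ is compact and hence admits a singular value decomposition $\{(\sigma_l,\varphi_l,\psi_l):l\in\mathbb{N}\}$, with singular values $\sigma_l$, right singular vectors $\varphi_l\in\mathbb{X}$ and left singular vectors $\psi_l\in\mathbb{Y}$. The operator equation is rewritten as the diagonal equation in sequence spaces $y_l=\sigma_l v_l+n_l$, $l\in\mathbb{N}$, with observables $y_l:=\langle\mathrm{Cov}[n]^{-1/2}\tau,\psi_l\rangle_{\mathbb{Y}}$ and unknowns $v_l:=\langle v,\varphi_l\rangle_{\mathbb{X}}$, where, due to Gaussianity, the noise $(n_l)_{l\in\mathbb{N}}$ is a sequence of uncorrelated $\mathcal{N}(0,1)$ random variables. For a diagonal estimator $W_\lambda\tau:=\sum_{l}\frac{\lambda_l}{\sigma_l}\langle\mathrm{Cov}[n]^{-1/2}\tau,\psi_l\rangle_{\mathbb{Y}}\varphi_l$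 with real weights $\lambda_l$, the risk (defined below) is $R(W_\lambda,v)=\sum_{l\in\mathbb{N}}\big[(1-\lambda_l)^2v_l^2+\lambda_l^2/\sigma_l^2\big]$. Risk. An estimator is an operator $W:\mathbb{Y}\to\mathbb{X}$ that maps observations $\tau$ to an approximation $W\tau$ of $v$. Its risk (expected square error) at $v$ is $R(W,v)=\mathbb{E}\big[\|W(Kv+n)-v\|^2\big]$; for linear $W$ this equals $\|(WK-I)v\|^2+\mathbb{E}[\|Wn\|^2]$. The maximal risk on a set $\Theta\subset\mathbb{X}$ is $R(W,\Theta)=\sup_{v\in\Theta}R(W,v)$. The minimax linear risk is $R^L(\Theta)=\inf_{W\text{ linear}}R(W,\Theta)$. A linear estimator $W$ that attains this infimum is called a minimax linear estimator on $\Theta$.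
   Formalization: The singular values are assumed positive and the right singular vectors φ_l an orthonormal basis of X (K injective), as the risk formula presupposes; if K had a kernel, Θ would contain it, every linear estimator would have infinite maximal risk, and uniqueness would fail. *)

(* Defs.v *)
From HB Require Import structures.
From mathcomp Require Import all_boot all_order all_algebra.
From mathcomp Require Import all_classical all_reals all_analysis.
Set Implicit Arguments.
Unset Strict Implicit.
Unset Printing Implicit Defensive.
From mathcomp Require Import measurable_realfun ring lra.
Import Order.TTheory GRing.Theory Num.Theory.
Import numFieldNormedType.Exports.
Local Open Scope classical_set_scope.
Local Open Scope ring_scope.
Local Open Scope quotient_scope.

Section VectorL2.
Context d (T : measurableType d) (R : realType).
Variables (mu : {measure set T -> \bar R}) (N : nat).

Definition rawL2 : Type := 'I_N -> LfunType mu (lee1n 2).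
HB.instance Definition _ := GRing.Lmodule.on rawL2.
HB.instance Definition _ := Choice.on rawL2.

Definition ae_eq_vec (u v : rawL2) : bool :=
  `[< forall i, (u i : T -> R) = v i %[ae mu] >].

Let ae_eq_vec_refl : reflexive ae_eq_vec.
Proof. by move=> u; apply/asboolP => i; exact: ae_eq_refl. Qed.

Let ae_eq_vec_sym : symmetric ae_eq_vec.
Proof.
by move=> u v; apply/idP/idP => /asboolP h; apply/asboolP => i; apply: ae_eq_sym; exact: h.
Qed.

Let ae_eq_vec_trans : transitive ae_eq_vec.
Proof.
move=> v u w /asboolP uv /asboolP vw; apply/asboolP => i.
exact: (ae_eq_trans (uv i) (vw i)).
Qed.

Canonical ae_eq_vec_equiv :=
  EquivRel ae_eq_vec ae_eq_vec_refl ae_eq_vec_sym ae_eq_vec_trans.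

(* The Hilbert space L^2(mu; R^N) = L^2(mu)^N. *)
Definition vecL2 : Type := {eq_quot ae_eq_vec}.
HB.instance Definition _ := Choice.on vecL2.
HB.instance Definition _ := EqQuotient.on vecL2.

Implicit Types (x y z : rawL2) (u v w : vecL2).

Let rawDE x y i t : (x + y : rawL2) i t = x i t + y i t. Proof. by []. Qed.
Let rawNE x i t : (- x : rawL2) i t = - x i t. Proof. by []. Qed.
Let rawZE a x i t : (a *: x : rawL2) i t = a * x i t. Proof. by []. Qed.

Lemma vecL2_eqP x y :
  (forall i, (x i : T -> R) = y i %[ae mu]) <-> \pi_vecL2 x = \pi_vecL2 y.
Proof.
split=> [xy|/eqP]; first by apply/eqP; rewrite eqmodE; exact/asboolP.
by rewrite eqmodE => /asboolP.
Qed.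

Lemma vecL2_reprP x i : (repr (\pi_vecL2 x) i : T -> R) = x i %[ae mu].
Proof. by move: i; apply/vecL2_eqP; rewrite reprK. Qed.

Definition vecL2_add u v : vecL2 := \pi_vecL2 (repr u + repr v : rawL2).
Definition vecL2_opp u : vecL2 := \pi_vecL2 (- repr u : rawL2).
Definition vecL2_scale (a : R) u : vecL2 := \pi_vecL2 (a *: repr u : rawL2).

Let piD x y : vecL2_add (\pi_vecL2 x) (\pi_vecL2 y) = \pi_vecL2 (x + y : rawL2).
Proof.
apply/vecL2_eqP => i.
have := vecL2_reprP x i; have := vecL2_reprP y i.
by apply: filterS2 => t yt xt _; rewrite !rawDE yt// xt.
Qed.

Let piN x : vecL2_opp (\pi_vecL2 x) = \pi_vecL2 (- x : rawL2).
Proof.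
apply/vecL2_eqP => i.
have := vecL2_reprP x i.
by apply: filterS => t xt _; rewrite !rawNE xt.
Qed.

Let piZ a x : vecL2_scale a (\pi_vecL2 x) = \pi_vecL2 (a *: x : rawL2).
Proof.
apply/vecL2_eqP => i.
have := vecL2_reprP x i.
by apply: filterS => t xt _; rewrite !rawZE xt.
Qed.

Let addA : associative vecL2_add.
Proof.
elim/quotW=> x; elim/quotW=> y; elim/quotW=> z.
by rewrite (piD y z) (piD x y) !piD addrA.
Qed.

Let addC : commutative vecL2_add.
Proof. by move=> u v; rewrite /vecL2_add addrC. Qed.

Let add0 : left_id (\pi_vecL2 (0 : rawL2)) vecL2_add.
Proof. by elim/quotW=> x; rewrite piD add0r. Qed.

Let addN : left_inverse (\pi_vecL2 (0 : rawL2)) vecL2_opp vecL2_add.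
Proof. by elim/quotW=> x; rewrite (piN x) piD addNr. Qed.

HB.instance Definition _ := GRing.isZmodule.Build vecL2 addA addC add0 addN.

Let scaleA a b u : vecL2_scale a (vecL2_scale b u) = vecL2_scale (a * b) u.
Proof. by elim/quotW: u => x; rewrite (piZ b x) !piZ scalerA. Qed.

Let scale1 : left_id 1 vecL2_scale.
Proof. by elim/quotW=> x; rewrite piZ scale1r. Qed.

Let scaleDr : right_distributive vecL2_scale +%R.
Proof.
move=> a u v; rewrite -[u]reprK -[v]reprK.
by rewrite [\pi_vecL2 _ + _]piD !piZ [RHS]piD scalerDr.
Qed.

Let scaleDl u : {morph vecL2_scale^~ u : a b / a + b}.
Proof.
by move=> a b; elim/quotW: u => x; rewrite (piZ a x) (piZ b x) piZ [RHS]piD scalerDl.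
Qed.

HB.instance Definition _ := GRing.Zmodule_isLmodule.Build R vecL2
  scaleA scale1 scaleDr scaleDl.

Lemma vecL2_piD x y : \pi_vecL2 (x + y : rawL2) = \pi_vecL2 x + \pi_vecL2 y.
Proof. by rewrite [RHS]piD. Qed.

Lemma vecL2_piZ a x : \pi_vecL2 (a *: x : rawL2) = a *: \pi_vecL2 x.
Proof. by rewrite [RHS]piZ. Qed.

(* The inner product of L^2(mu)^N; the norm below is induced by it. *)
Definition ip u v : R :=
  \sum_(i < N) \int[mu]_t (repr u i t * repr v i t).

Lemma integrable_mulL2 (f g : LfunType mu (lee1n 2)) :
  mu.-integrable setT (EFin \o (f \* g : T -> R)).
Proof.
apply/Lfun1_integrable; apply: Lfun2_mul_Lfun1; exact: LfunP.
Qed.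

Lemma ip_pi x y :
  ip (\pi_vecL2 x) (\pi_vecL2 y) = \sum_(i < N) \int[mu]_t (x i t * y i t).
Proof.
apply: eq_bigr => i _; rewrite /Rintegral; congr fine.
apply: ae_eq_integral => //.
- by case/integrableP : (integrable_mulL2 (repr (\pi_vecL2 x) i)
    (repr (\pi_vecL2 y) i)).
- by case/integrableP : (integrable_mulL2 (x i) (y i)).
have := vecL2_reprP x i; have := vecL2_reprP y i.
by apply: filterS2 => t /= yt xt _; rewrite yt// xt.
Qed.

Lemma ipC u v : ip u v = ip v u.
Proof.
apply: eq_bigr => i _; apply: eq_Rintegral => t _.
by rewrite mulrC.
Qed.

Lemma ipDl u v w : ip (u + v) w = ip u w + ip v w.
Proof.
elim/quotW: u => x; elim/quotW: v => y; elim/quotW: w => z.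
rewrite -vecL2_piD !ip_pi -big_split/=.
apply: eq_bigr => i _; rewrite -RintegralD//; try exact: integrable_mulL2.
by apply: eq_Rintegral => t _; rewrite -mulrDl.
Qed.

Lemma ipZl a u v : ip (a *: u) v = a * ip u v.
Proof.
elim/quotW: u => x; elim/quotW: v => y; rewrite -vecL2_piZ !ip_pi mulr_sumr.
apply: eq_bigr => i _; rewrite -RintegralZl//; try exact: integrable_mulL2.
by apply: eq_Rintegral => t _; rewrite mulrA.
Qed.

Lemma ip_ge0 u : 0 <= ip u u.
Proof.
apply: sumr_ge0 => i _; apply: Rintegral_ge0 => t _.
by rewrite -expr2 sqr_ge0.
Qed.

Lemma ip_eq0 u : ip u u = 0 -> u = 0.
Proof.
elim/quotW: u => x; rewrite ip_pi => /eqP.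
rewrite psumr_eq0; last first.
  by move=> i _; apply: Rintegral_ge0 => t _; rewrite -expr2 sqr_ge0.
move=> /allP h; apply/vecL2_eqP => i.
have {}h := eqP (h i (mem_index_enum i)).
pose f : T -> \bar R := fun t => (x i t * x i t)%:E.
have mf : measurable_fun [set: T] f.
  by case/integrableP : (integrable_mulL2 (x i) (x i)).
have : (\int[mu]_t `|f t| = 0)%E.
  rewrite -[RHS]/(0%:E) -{}h /Rintegral fineK; last first.
    by apply: integrable_fin_num => //; exact: integrable_mulL2.
  by apply: eq_integral => t _ /=; rewrite ger0_norm// -expr2 sqr_ge0.
move=> /(ae_eq_integral_abs mu measurableT mf).
apply: filterS => t /= /[apply] -[] /eqP.
by rewrite mulf_eq0 orbb => /eqP.
Qed.

Lemma ip_cauchy_schwarz u v : ip u v ^+ 2 <= ip u u * ip v v.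
Proof.
have ipDr w w1 w2 : ip w (w1 + w2) = ip w w1 + ip w w2.
  by rewrite ipC ipDl !(ipC w).
have ipZr a w w' : ip w (a *: w') = a * ip w w' by rewrite ipC ipZl ipC.
have [v0|v0] := eqVneq (ip v v) 0.
  have := ip_eq0 v0 => ->; rewrite -(scale0r (0 : vecL2)) !ipZr !mul0r mulr0.
  by rewrite expr0n.
have vp : 0 < ip v v by rewrite lt_neqAle eq_sym v0 ip_ge0.
have := ip_ge0 (ip v v *: u + (- ip u v) *: v).
rewrite !ipDl !ipDr !ipZl !ipZr (ipC v u).
set A := ip u u; set B := ip v v; set C := ip u v => h.
rewrite -subr_ge0 -(pmulr_rge0 _ vp).
by rewrite (le_trans h)// le_eqVlt -/B; apply/orP; left; apply/eqP; ring.
Qed.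

Definition vecL2_norm u : R := Num.sqrt (ip u u).

Let ler_normD u v : vecL2_norm (u + v) <= vecL2_norm u + vecL2_norm v.
Proof.
rewrite -(@ler_pXn2r _ 2)// ?nnegrE ?addr_ge0 ?sqrtr_ge0//.
rewrite sqrrD !sqr_sqrtr ?ip_ge0// !(ipDl, ipC _ (u + v)) (ipC v u).
rewrite -!addrA lerD2l !addrA lerD2r -mulr2n lerMn2r/=.
rewrite (le_trans (ler_norm _))// -sqrtr_sqr -sqrtrM ?ip_ge0//.
by rewrite ler_wsqrtr// ip_cauchy_schwarz.
Qed.

Let normrZ (a : R) u : vecL2_norm (a *: u) = `|a| * vecL2_norm u.
Proof.
rewrite /vecL2_norm ipZl ipC ipZl mulrA -expr2 sqrtrM ?sqr_ge0//.
by rewrite sqrtr_sqr.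
Qed.

Let normr0_eq0 u : vecL2_norm u = 0 -> u = 0.
Proof.
move=> /eqP; rewrite sqrtr_eq0 => u0; apply: ip_eq0; apply/eqP.
by rewrite eq_le u0 ip_ge0.
Qed.

HB.instance Definition _ := @Lmodule_isNormed.Build R vecL2 vecL2_norm
  ler_normD normrZ normr0_eq0.

Lemma vecL2_normE u : `|u| = Num.sqrt (ip u u).
Proof. by []. Qed.
End VectorL2.

Section Square.
Variable R : realType.

Definition square : set (measurableTypeR R * measurableTypeR R) :=
  `[- pi, pi] `*` `[- pi, pi].

Lemma measurable_square : measurable square.
Proof. by apply: measurableX; exact: measurable_itv. Qed.

(* Two-dimensional Lebesgue measure restricted to [-pi, pi]^2. *)
Definition square_measure :
    {measure set (measurableTypeR R * measurableTypeR R) -> \bar R} :=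
  mrestr (lebesgue_measure \x lebesgue_measure)%E measurable_square.

End Square.

Notation L2square R N := (vecL2 (square_measure R) N).

Section Convolution.
Variable R : realType.

(* L^1 is the largest class of kernel functions for which the convolution
   integral converges almost everywhere against every square-integrable
   function. *)
Definition periodic_kernel
    (k : measurableTypeR R * measurableTypeR R -> R) : Prop :=
  [/\ forall s t, k (s + 2 * pi, t) = k (s, t),
      forall s t, k (s, t + 2 * pi) = k (s, t) &
      (square_measure R).-integrable setT (EFin \o k)].

Definition convolution (k f : measurableTypeR R * measurableTypeR R -> R)
    (r : measurableTypeR R * measurableTypeR R) : R :=
  \int[square_measure R]_r' (k (r.1 - r'.1, r.2 - r'.2) * f r').

Definition convolution_operator (M N : nat)
    (K : L2square R M -> L2square R N) : Prop :=
  exists2 k : 'I_N -> 'I_M -> measurableTypeR R * measurableTypeR R -> R,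
    forall i j, periodic_kernel (k i j) &
    forall v i, {ae square_measure R, forall r,
      repr (K v) i r = \sum_(j < M) convolution (k i j) (repr v j) r}.

End Convolution.

Section Operators.
Context (R : realType) d1 (T1 : measurableType d1) d2 (T2 : measurableType d2).
Variables (mu1 : {measure set T1 -> \bar R}) (mu2 : {measure set T2 -> \bar R}).
Variables (M N : nat).
Local Notation X := (vecL2 mu1 M).
Local Notation Y := (vecL2 mu2 N).

Definition compact_operator (A : X -> Y) : Prop :=
  precompact (A @` [set v | `|v| <= 1]).

Definition orthonormal_seq (phi : nat -> X) : Prop :=
  forall k l, ip (phi k) (phi l) = (k == l)%:R.

Definition hilbert_basis (phi : nat -> X) : Prop :=
  orthonormal_seq phi /\
  forall v, (fun m => \sum_(l < m) ip v (phi l) *: phi l) @ \oo --> v.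

End Operators.

Section SVD.
Context (R : realType) d1 (T1 : measurableType d1) d2 (T2 : measurableType d2).
Variables (mu1 : {measure set T1 -> \bar R}) (mu2 : {measure set T2 -> \bar R}).
Variables (M N : nat).
Local Notation X := (vecL2 mu1 M).
Local Notation Y := (vecL2 mu2 N).

(* The enumeration of the singular values is not assumed to be monotone. *)
Record singular_value_decomposition (A : X -> Y)
    (sigma : nat -> R) (phi : nat -> X) (psi : nat -> Y) : Prop := {
  svd_gt0 : forall l, 0 < sigma l;
  svd_right : orthonormal_seq phi;
  svd_left : orthonormal_seq psi;
  svd_expansion : forall v,
    (fun m => \sum_(l < m) (sigma l * ip v (phi l)) *: psi l) @ \oo --> A v
}.

End SVD.

Section Noise.
Context (R : realType) d (T : measurableType d).
Variables (mu : {measure set T -> \bar R}) (N : nat).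
Local Notation Y := (vecL2 mu N).

Definition strictly_positive_definite (C : Y -> Y) : Prop :=
  exists2 c : R, 0 < c & forall y, c * `|y| ^+ 2 <= ip (C y) y.

(* S = C^(-1/2): the positive self-adjoint square root of the inverse of C. *)
Record inverse_sqrt (C S : Y -> Y) : Prop := {
  inverse_sqrt_sym : forall y z, ip (S y) z = ip y (S z);
  inverse_sqrt_ge0 : forall y, 0 <= ip (S y) y;
  inverse_sqrt_left : forall y, S (S (C y)) = y;
  inverse_sqrt_right : forall y, C (S (S y)) = y
}.

Context d' (Omega : measurableType d') (P : probability Omega R).

(* A Hilbert space process is given by its pairings n y = <n, y> with the
   elements of Y. It need not come from a Y-valued random variable: a process
   with strictly positive definite covariance on an infinite-dimensional space
   never does.

   The normal law is stated for y != 0 because normal_prob m 0 is not the Dirac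
   measure at m. *)
Record gaussian_process (C : Y -> Y) (n : Y -> {RV P >-> R}) : Prop := {
  process_linear : forall a y z,
    {ae P, forall w, n (a *: y + z) w = a * n y w + n z w};
  process_L2 : forall y, (n y : Omega -> R) \in Lfun P 2%:E;
  process_mean : forall y, ('E_P[n y] = 0)%E;
  process_cov : forall y z, covariance P (n y) (n z) = (ip (C y) z)%:E;
  process_normal : forall y, y != 0 -> forall B, measurable B ->
    distribution P (n y) B = normal_prob 0 (Num.sqrt (ip (C y) y)) B
}.

End Noise.

Section Risk.
Context (R : realType) d1 (T1 : measurableType d1) d2 (T2 : measurableType d2).
Variables (mu1 : {measure set T1 -> \bar R}) (mu2 : {measure set T2 -> \bar R}).
Variables (M N : nat).
Local Notation X := (vecL2 mu1 M).
Local Notation Y := (vecL2 mu2 N).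
Context d (Omega : measurableType d) (P : probability Omega R).
Variables (K : X -> Y) (n : Y -> {RV P >-> R}).

(* xi is an X-valued version of W n: <xi, x> = <n, y> almost surely whenever
   y = W^* x, the adjoint relation being written out. *)
Definition noise_image (W : Y -> X) (xi : Omega -> X) : Prop :=
  (forall x, measurable_fun [set: Omega] (fun w => ip (xi w) x)) /\
  (forall x y, (forall z, ip (W z) x = ip z y) ->
     {ae P, forall w, ip (xi w) x = n y w}).

(* E |W (K v + n) - v|^2. Two versions of W n agree almost surely, so that the
   infimum is over at most one value; it is +oo when W n has no X-valued
   version, which is the case where the covariance of W n has infinite trace. *)
Definition risk (W : Y -> X) (v : X) : \bar R :=
  ereal_inf [set (\int[P]_w (`|W (K v) + xi w - v| ^+ 2)%:E)%E
            | xi in noise_image W].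

Definition max_risk (W : Y -> X) (Theta : set X) : \bar R :=
  ereal_sup [set risk W v | v in Theta].

(* Linear estimators are continuous: W n is defined by duality. *)
Definition minimax_linear_risk (Theta : set X) : \bar R :=
  ereal_inf [set max_risk W Theta
            | W in [set W : {linear Y -> X} | continuous W]].

Definition minimax_linear_estimator (W : {linear Y -> X}) (Theta : set X) :
    Prop :=
  continuous W /\ max_risk W Theta = minimax_linear_risk Theta.

End Risk.

Section Ellipsoid.
Context (R : realType) d (T : measurableType d).
Variables (mu : {measure set T -> \bar R}) (N : nat).

Definition ellipsoid (phi : nat -> vecL2 mu N) (a : nat -> R) (Q : R) :
    set (vecL2 mu N) :=
  [set v | (\sum_(0 <= l <oo) (a l ^+ 2 * ip v (phi l) ^+ 2)%:E <= Q%:E)%E].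

End Ellipsoid.

(* The series is taken in the extended reals: for kappa <= 0 it diverges. *)
Definition kappa_equation (R : realType) (sigma a : nat -> R) (Q kappa : R) :
    Prop :=
  ((kappa * Q)%:E -
   \sum_(0 <= l <oo) (a l / sigma l ^+ 2 * Num.max (1 - kappa * a l) 0)%:E
   = 0)%E.

(* Main.v *)
Require Import Defs.
From HB Require Import structures.
From mathcomp Require Import all_boot all_order all_algebra.
From mathcomp Require Import all_classical all_reals all_analysis.
From mathcomp Require Import measurable_realfun ring lra.
Set Implicit Arguments.
Unset Strict Implicit.
Unset Printing Implicit Defensive.
Import Order.TTheory GRing.Theory Num.Theory.
Import numFieldNormedType.Exports.
Local Open Scope classical_set_scope.
Local Open Scope ring_scope.

(** The whitened operator S K, with S = Cov^(-1/2), is diagonal in the singular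
    system, so the problem is a diagonal Gaussian sequence model; the theorem is
    Pinsker's linear minimax theorem for it.

    Write lambda l = max (1 - kappa a_l, 0). Since a_l tends to infinity only
    finitely many weights are nonzero: the optimal filter has finite rank, and
    the sums of the weights are finite sums.

    Risk. A continuous linear W has an adjoint vector y l with
    <W z, phi_l> = <z, y l> (adjoint_exists), and by Parseval the risk of W at
    v is the sum over l of <W K v - v, phi_l>^2 + <Cov (y l), y l>, provided
    that W n has a version with values in X, and +oo otherwise (risk_ge,
    risk_le). With the whitened adjoint z l = S (Cov (y l)) the noise term is
    |z l|^2, and S (z l) = y l, so that the vectors z l determine W.

    Upper bound. For the filter, z l = (lambda l / sigma l) psi_l. Because
    1 - lambda l <= kappa a_l, its risk on the ellipsoid is at most
    kappa^2 Q + sum (lambda l / sigma l)^2, and the equation for kappa turns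
    this into sum lambda l / sigma_l^2 (max_risk_filter).

    Lower bound. Put c l = lambda l / (sigma_l^2 (1 - lambda l)); the equation
    for kappa says that the signals with squared coordinates c l are on the
    boundary of the ellipsoid. The signs of the coordinates can be chosen so
    that the bias of a given W is at least what the diagonal of the quadratic
    form u |-> |W K u - u|^2 yields (sign_choice). Completing the square in each
    coordinate then gives

      max_risk W >= sum_l (lambda l / sigma_l^2
                           + |z l - (lambda l / sigma l) psi_l|^2)

    (max_risk_lower_bound). The first summands give the minimax value; a W that
    attains it has vanishing second summands, hence the adjoint vectors of the
    filter, hence is the filter (minimax_unique).

    The adjoint vectors come from the Riesz representation theorem, which rests
    on the completeness of L^2 (Lfun2_geometric_cauchy). *)

(** * Hilbert space calculus in L^2 *)

Section InnerProduct.
Context (R : realType) d (T : measurableType d).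
Variables (mu : {measure set T -> \bar R}) (N : nat).
Local Notation H := (vecL2 mu N).
Implicit Types u v w : H.

Lemma ipDr u v w : ip u (v + w) = ip u v + ip u w.
Proof. by rewrite ipC ipDl (ipC v) (ipC w). Qed.

Lemma ipZr (a : R) u v : ip u (a *: v) = a * ip u v.
Proof. by rewrite ipC ipZl ipC. Qed.

Lemma ip0l u : ip 0 u = 0.
Proof. by rewrite -(scale0r (0 : H)) ipZl mul0r. Qed.

Lemma ipNl u v : ip (- u) v = - ip u v.
Proof. by rewrite -scaleN1r ipZl mulN1r. Qed.

Lemma ipNr u v : ip u (- v) = - ip u v.
Proof. by rewrite ipC ipNl ipC. Qed.

Lemma ipBl u v w : ip (u - v) w = ip u w - ip v w.
Proof. by rewrite ipDl ipNl. Qed.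

Lemma ipBr u v w : ip u (v - w) = ip u v - ip u w.
Proof. by rewrite ipDr ipNr. Qed.

Lemma ip_suml (I : Type) (r : seq I) (P : pred I) (F : I -> H) v :
  ip (\sum_(i <- r | P i) F i) v = \sum_(i <- r | P i) ip (F i) v.
Proof.
apply: (big_morph (fun u => ip u v)) => [x y|]; first exact: ipDl.
exact: ip0l.
Qed.

Lemma ip_norm u : ip u u = `|u| ^+ 2.
Proof. by rewrite vecL2_normE sqr_sqrtr// ip_ge0. Qed.

Lemma ip_inj u v : (forall w, ip u w = ip v w) -> u = v.
Proof.
move=> uv; apply/eqP; rewrite -subr_eq0; apply/eqP/ip_eq0.
by rewrite ipBl uv subrr.
Qed.

Lemma ip_le_norm u v : `|ip u v| <= `|u| * `|v|.
Proof.
rewrite -(@ler_pXn2r _ 2)// ?nnegrE ?mulr_ge0//.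
by rewrite exprMn -!ip_norm real_normK ?num_real// ip_cauchy_schwarz.
Qed.

Lemma parallelogram u v :
  `|u + v| ^+ 2 + `|u - v| ^+ 2 = 2 * (`|u| ^+ 2 + `|v| ^+ 2).
Proof. by rewrite -!ip_norm !(ipDl, ipDr, ipNl, ipNr); ring. Qed.

Lemma cvg_ipl (I : Type) (F : set_system I) {FF : ProperFilter F}
    (f : I -> H) u w : f @ F --> u -> (fun i => ip (f i) w) @ F --> ip u w.
Proof.
move=> fu; apply/cvgrPdist_le => e e0.
have w1 : 0 < `|w| + 1 by rewrite ltr_wpDl.
move/cvgrPdist_le : fu => /(_ _ (divr_gt0 e0 w1)).
apply: filterS => i; rewrite ler_pdivlMr// => h.
rewrite -ipBl (le_trans (ip_le_norm _ _))// (le_trans _ h)//.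
by rewrite ler_wpM2l// lerDl.
Qed.

End InnerProduct.

(** * Completeness of L^2 *)

Section Completeness.
Context (R : realType) d (T : measurableType d).
Variable mu : {measure set T -> \bar R}.

(** The sequences x k -/+ 2 M 2^-k are monotone and squeeze x, which yields the
    limit together with the rate. *)
Lemma geometric_cauchy (x : R^nat) (M : R) :
    (forall k, `|x k.+1 - x k| <= M * 2^-1 ^+ k) ->
  exists l, x @ \oo --> l /\ forall k, `|l - x k| <= 2 * M * 2^-1 ^+ k.
Proof.
move=> xM.
have M0 : 0 <= M by have := xM 0%N; rewrite expr0 mulr1; apply: le_trans.
have e0 k : 0 <= 2^-1 ^+ k :> R by rewrite exprn_ge0// invr_ge0.
pose lo k := x k - 2 * M * 2^-1 ^+ k; pose hi k := x k + 2 * M * 2^-1 ^+ k.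
have half : (fun k => 2 * M * 2^-1 ^+ k) @ \oo --> (0 : R).
  rewrite -[X in _ --> X](mulr0 (2 * M)); apply: cvgMr; apply: cvg_expr.
  by rewrite ger0_norm ?invr_ge0// invf_lt1 ?ltr1n.
have nd_lo : nondecreasing_seq lo.
  apply/nondecreasing_seqP => k; rewrite /lo exprS.
  have := xM k; rewrite ler_norml => /andP[+ _]; lra.
have ni_hi : nonincreasing_seq hi.
  apply/nonincreasing_seqP => k; rewrite /hi exprS.
  have := xM k; rewrite ler_norml => /andP[_ +]; lra.
have lohi k : lo k <= hi k.
  by have := mulr_ge0 M0 (e0 k); rewrite /lo /hi; lra.
have lo_cvg : cvgn lo.
  apply: nondecreasing_is_cvgn => //; exists (hi 0%N) => _ [k _ <-].
  exact: le_trans (lohi k) (ni_hi _ _ (leq0n k)).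
have lo_l : lo @ \oo --> limn lo by [].
set l := limn lo in lo_l *.
have x_l : x @ \oo --> l.
  rewrite -[l]addr0 (_ : x = lo \+ (fun k => 2 * M * 2^-1 ^+ k)).
    exact: cvgD.
  by apply/funext => k /=; rewrite subrK.
have hi_l : hi @ \oo --> l by rewrite -[l]addr0; exact: cvgD.
exists l; split=> // k.
have := nondecreasing_cvgn_le nd_lo lo_cvg k.
have := nonincreasing_cvgn_ge ni_hi (cvgP _ hi_l) k.
rewrite (cvg_lim _ hi_l)// /lo /hi -/l ler_norml => ? ?.
by apply/andP; split; lra.
Qed.

Lemma Lfun2_sqr (f : T -> R) : measurable_fun [set: T] f ->
  (\int[mu]_t (f t ^+ 2)%:E < +oo)%E -> f \in Lfun mu 2%:E.
Proof.
move=> mf if2; rewrite inE/=; apply/andP; split; rewrite inE//=.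
rewrite /finite_norm unlock poweR_lty//.
apply: le_lt_trans if2; rewrite le_eqVlt; apply/orP; left; apply/eqP.
apply: eq_integral => t _ /=.
by rewrite powR_mulrn// real_normK// num_real.
Qed.

Lemma sum_half_le2 n : \sum_(0 <= k < n) 2^-1 ^+ k <= 2 :> R.
Proof.
suff -> : \sum_(0 <= k < n) 2^-1 ^+ k = 2 - 2 * 2^-1 ^+ n :> R.
  by rewrite lerBlDr lerDl mulr_ge0// exprn_ge0// invr_ge0.
elim: n => [|n ih]; first by rewrite big_geq// expr0 mulr1 subrr.
by rewrite big_nat_recr//= ih exprS; field.
Qed.

(** The weighted square function G = sum_k 4^k (f (k+1) - f k)^2 is integrable,
    hence finite almost everywhere. Where it is finite, |f (k+1) - f k| is at
    most sqrt G 2^-k, so f k converges to some g with (g - f k)^2 <= 4 4^-k G;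
    integrating this bound gives the convergence in L^2. *)
Lemma Lfun2_geometric_cauchy (f : nat -> LfunType mu (lee1n 2)) :
    (forall k, \int[mu]_t ((f k.+1 t - f k t) ^+ 2)%:E <= (8^-1 ^+ k)%:E)%E ->
  exists g : LfunType mu (lee1n 2),
    (fun k => (\int[mu]_t ((g t - f k t) ^+ 2)%:E)%E) @ \oo --> 0%E.
Proof.
move=> hf.
pose D k t : \bar R := (4 ^+ k * (f k.+1 t - f k t) ^+ 2)%:E.
pose G t := (\sum_(0 <= k <oo) D k t)%E.
have mfk k : measurable_fun [set: T] (f k : T -> R) by [].
have mD k : measurable_fun [set: T] (D k).
  apply/measurable_EFinP; apply: measurable_funM => //.
  by apply: measurable_funX; exact: measurable_funB.
have D0 k t : (0 <= D k t)%E by rewrite lee_fin mulr_ge0 ?sqr_ge0 ?exprn_ge0.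
have G0 t : (0 <= G t)%E by exact: nneseries_ge0.
have mG : measurable_fun [set: T] G.
  by apply: ge0_emeasurable_sum => // k t _ _.
have iG : (\int[mu]_t G t <= 2%:E)%E.
  rewrite integral_nneseries//.
  apply: lime_le; first by apply: is_cvg_nneseries => k _ _; exact: integral_ge0.
  apply: nearW => n.
  apply: (@le_trans _ _ (\sum_(0 <= k < n) (2^-1 ^+ k)%:E)%E); last first.
    by rewrite sumEFin lee_fin sum_half_le2.
  apply: lee_sum => k _; rewrite /D.
  under eq_integral do rewrite EFinM.
  rewrite ge0_integralZl//; last first.
  - by move=> t _; rewrite lee_fin sqr_ge0.
  - apply/measurable_EFinP.
    by apply: measurable_funX; exact: measurable_funB.
  apply: (@le_trans _ _ ((4 ^+ k)%:E * (8^-1 ^+ k)%:E)%E).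
    by rewrite lee_pmul2l// lte_fin exprn_gt0.
  rewrite -EFinM lee_fin -exprMn (_ : 4 * 8^-1 = 2^-1)//; lra.
pose E := [set t | G t < +oo]%E.
have mE : measurable E.
  rewrite -[E]setTI.
  exact: emeasurable_fun_infty_o.
have step k t : E t -> `|f k.+1 t - f k t| <= Num.sqrt (fine (G t)) * 2^-1 ^+ k.
  move=> Et.
  have GE : (fine (G t))%:E = G t by rewrite fineK// ge0_fin_numE.
  rewrite -(@ler_pXn2r _ 2)// ?nnegrE ?mulr_ge0 ?sqrtr_ge0 ?exprn_ge0//.
  rewrite exprMn sqr_sqrtr ?fine_ge0// real_normK ?num_real//.
  rewrite -exprM mulnC exprM.
  rewrite (_ : 2^-1 ^+ 2 = 4^-1); last by lra.
  rewrite exprVn ler_pdivlMr ?exprn_gt0// mulrC -lee_fin GE.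
  by rewrite /G (@nneseriesD1 _ (D^~ t) k xpredT)//= leeDl// nneseries_ge0.
(* cutting off with E makes the limit exist, and be measurable, everywhere *)
have ex_l t : exists l, (fun k => f k t * \1_E t) @ \oo --> l /\ (E t ->
    forall k, `|l - f k t| <= 2 * Num.sqrt (fine (G t)) * 2^-1 ^+ k).
  rewrite indicE.
  have [Et|Et] := pselect (E t); last first.
    exists 0; rewrite memNset//; split=> //.
    by under eq_fun do rewrite mulr0; exact: cvg_cst.
  rewrite (_ : (fun k => _) = fun k => f k t); last first.
    by apply/funext => k; rewrite mem_set// mulr1.
  by have [l [fl hl]] := geometric_cauchy (step ^~ t ^~ Et); exists l.
have [g g_cvg] := choice ex_l.
have mg : measurable_fun [set: T] g.
  apply: (@measurable_fun_cvg _ _ _ _ (fun k t => f k t * \1_E t)).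
    by move=> k; apply: measurable_funM => //; exact: measurable_indic.
  by move=> t _; exact: (g_cvg t).1.
have gf k t : (((g t - f k t) ^+ 2)%:E <= (4 * 4^-1 ^+ k)%:E * G t)%E.
  (* off E the right-hand side is infinite *)
  have [Et|Et] := pselect (E t); last first.
    have -> : G t = +oo%E by apply/eqP; rewrite -leye_eq leNgt; exact/negP.
    by rewrite gt0_muley ?leey// lte_fin mulr_gt0// exprn_gt0// invr_gt0.
  have GE : (fine (G t))%:E = G t by rewrite fineK// ge0_fin_numE.
  rewrite -GE -EFinM lee_fin.
  rewrite -real_normK ?num_real//.
  apply: (@le_trans _ _ ((2 * Num.sqrt (fine (G t)) * 2^-1 ^+ k) ^+ 2)).
    rewrite ler_pXn2r// ?nnegrE ?mulr_ge0 ?sqrtr_ge0 ?exprn_ge0//.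
    exact: (g_cvg t).2.
  rewrite !exprMn sqr_sqrtr ?fine_ge0// -exprM mulnC exprM.
  rewrite (_ : 2^-1 ^+ 2 = 4^-1); last by lra.
  by rewrite le_eqVlt; apply/orP; left; apply/eqP; ring.
have mgf k : measurable_fun [set: T] (fun t => (g t - f k t) ^+ 2).
  by apply: measurable_funX; exact: measurable_funB.
have igf k : (\int[mu]_t ((g t - f k t) ^+ 2)%:E <= (8 * 4^-1 ^+ k)%:E)%E.
  apply: (@le_trans _ _ (\int[mu]_t ((4 * 4^-1 ^+ k)%:E * G t))%E).
    apply: ge0_le_integral => //.
    - by move=> t _; rewrite lee_fin sqr_ge0.
    - exact/measurable_EFinP.
    - exact: measurable_funeM.
  rewrite ge0_integralZl//.
  apply: (@le_trans _ _ ((4 * 4^-1 ^+ k)%:E * 2%:E)%E).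
    by rewrite lee_pmul2l// lte_fin mulr_gt0// exprn_gt0// invr_gt0.
  by rewrite -EFinM lee_fin mulrAC -natrM.
have gL : g \in Lfun mu 2%:E.
  rewrite (_ : g = (fun t => g t - f 0%N t) \+ f 0%N); last first.
    by apply/funext => t /=; rewrite subrK.
  rewrite rpredD ?lee1n// => ?; last exact: LfunP (f 0%N).
  apply: Lfun2_sqr; first exact: measurable_funB.
  by rewrite (le_lt_trans (igf 0%N))// ltry.
exists (Lfun_Sub (lee1n 2) gL).
apply: (@squeeze_cvge _ _ _ _ (cst 0%E) _ (fun k => (8 * 4^-1 ^+ k)%:E)).
- apply: nearW => k; rewrite /= igf andbT.
  by apply: integral_ge0 => t _; rewrite lee_fin sqr_ge0.
- exact: cvg_cst.
- apply: cvg_EFin; first exact: nearW.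
  rewrite -[X in _ --> X](mulr0 8); apply: cvgMr; apply: cvg_expr.
  by rewrite ger0_norm ?invr_ge0// invf_lt1 ?ltr1n.
Qed.

End Completeness.

Section Riesz.
Context (R : realType) d (T : measurableType d).
Variables (mu : {measure set T -> \bar R}) (N : nat).
Local Notation H := (vecL2 mu N).

Lemma norm_pi (x : rawL2 mu N) :
  (`|\pi_(vecL2 mu N)%qT x| ^+ 2)%:E =
  (\sum_(i < N) \int[mu]_t (x i t ^+ 2)%:E)%E.
Proof.
rewrite -ip_norm ip_pi -sumEFin; apply: eq_bigr => i _.
rewrite /Rintegral fineK//.
by apply: integrable_fin_num => //; exact: integrable_mulL2.
Qed.

Lemma norm_sub_pi (x y : rawL2 mu N) :
  (`|\pi_(vecL2 mu N)%qT x - \pi_(vecL2 mu N)%qT y| ^+ 2)%:E =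
  (\sum_(i < N) \int[mu]_t ((x i t - y i t) ^+ 2)%:E)%E.
Proof.
have -> : \pi_(vecL2 mu N)%qT x - \pi_(vecL2 mu N)%qT y =
          \pi_(vecL2 mu N)%qT (x + (-1) *: y).
  by rewrite vecL2_piD vecL2_piZ scaleN1r.
rewrite norm_pi; apply: eq_bigr => i _; apply: eq_integral => t _.
by rewrite -[(x + _) i t]/(x i t + -1 * y i t) mulN1r.
Qed.

Lemma vecL2_geometric_cauchy (u : nat -> H) :
  (forall k, `|u k.+1 - u k| ^+ 2 <= 8^-1 ^+ k) -> exists v : H, u @ \oo --> v.
Proof.
move=> hu.
have sq0 i (f g : 'I_N -> LfunType mu (lee1n 2)) :
    (0 <= \int[mu]_t ((f i t - g i t) ^+ 2)%:E)%E.
  by apply: integral_ge0 => t _; rewrite lee_fin sqr_ge0.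
have hf i k : (\int[mu]_t ((repr (u k.+1) i t - repr (u k) i t) ^+ 2)%:E
    <= (8^-1 ^+ k)%:E)%E.
  apply: (@le_trans _ _ (`|u k.+1 - u k| ^+ 2)%:E); last by rewrite lee_fin.
  rewrite -[u k.+1]reprK -[u k]reprK norm_sub_pi !reprK.
  rewrite (bigD1 i)//= leeDl//; apply: sume_ge0 => j _; exact: sq0.
have [g gP] := choice (fun i => Lfun2_geometric_cauchy (hf i)).
exists (\pi_(vecL2 mu N)%qT g).
have : (fun k => (`|\pi_(vecL2 mu N)%qT g - u k| ^+ 2)%:E) @ \oo --> 0%E.
  rewrite (_ : (fun k => _) = fun k => (\sum_(i < N)
      \int[mu]_t ((g i t - repr (u k) i t) ^+ 2)%:E)%E); last first.
    by apply/funext => k; rewrite -[in LHS](reprK (u k)) norm_sub_pi.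
  rewrite [X in _ --> X](_ : _ = (\sum_(i < N) 0)%E); last by rewrite big1.
  by apply: cvg_nnesum => i _; [exact: nearW|exact: gP].
move=> /fine_cvgP[_ h]; apply/cvgrPdist_lt => e e0.
move/cvgrPdist_lt : h => /(_ _ (exprn_gt0 2 e0)).
apply: filterS => k; rewrite sub0r normrN/= ger0_norm ?sqr_ge0//.
by rewrite ltr_pXn2r// nnegrE// ltW.
Qed.

(** The representing vector minimizes the functional J x = |x|^2 - 2 f x: by the
    parallelogram identity a sequence with J (u k) < inf J + 8^-k / 4 converges
    geometrically, and the first variation of J vanishes at its limit. *)
Lemma riesz (f : H -> R) (C : R) :
    (forall a x y, f (a *: x + y) = a * f x + f y) ->
    (forall x, `|f x| <= C * `|x|) ->
  exists y, forall z, f z = ip z y.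
Proof.
move=> f_lin fC.
have fD x y : f (x + y) = f x + f y.
  by rewrite -[x in LHS]scale1r f_lin mul1r.
have f0 : f 0 = 0 by apply: (addrI (f 0)); rewrite -fD !addr0.
have fZ a x : f (a *: x) = a * f x by rewrite -[_ *: _]addr0 f_lin f0 addr0.
pose J (x : H) : R := `|x| ^+ 2 - 2 * f x.
have J_lb : has_lbound (range J).
  exists (- C ^+ 2) => _ [x _ <-]; rewrite /J.
  have /ler_normlP[_ fx] := fC x; have := sqr_ge0 (`|x| - C); nra.
have J_inf : has_inf (range J) by split => //; exists (J 0), 0.
set m := inf (range J).
have m_le x : m <= J x by apply: ge_inf => //; exists x.
have ex_u k : exists x, J x < m + 4^-1 * 8^-1 ^+ k.
  have e0 : 0 < 4^-1 * 8^-1 ^+ k :> R by rewrite mulr_gt0 ?exprn_gt0 ?invr_gt0.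
  by have [_ [x _ <-] xm] := inf_adherent e0 J_inf; exists x.
have [u uP] := choice ex_u.
have J_mid (x y : H) : J x + J y - 2 * J (2^-1 *: (x + y)) = 2^-1 * `|x - y| ^+ 2.
  have := parallelogram x y.
  have -> : J (2^-1 *: (x + y)) =
      4^-1 * `|x + y| ^+ 2 - (f x + f y).
    have fxy : f (2^-1 *: (x + y)) = 2^-1 * (f x + f y).
      by rewrite fZ fD.
    by rewrite /J fxy normrZ exprMn [X in X ^+ 2 * _]ger0_norm//; field.
  rewrite /J => h; have -> : `|x - y| ^+ 2 =
      2 * (`|x| ^+ 2 + `|y| ^+ 2) - `|x + y| ^+ 2 by rewrite -h; ring.
  by field.
have [y uy] : exists y : H, u @ \oo --> y.
  apply: vecL2_geometric_cauchy => k.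
  have := J_mid (u k.+1) (u k); have := m_le (2^-1 *: (u k.+1 + u k)).
  have := uP k; have := uP k.+1; rewrite exprS.
  have : 0 <= 8^-1 ^+ k :> R by rewrite exprn_ge0// invr_ge0.
  by move: (8^-1 ^+ k) => e; lra.
exists y => z.
(* first variation of J at y in the direction z *)
have pert t : 0 <= 2 * t * (ip y z - f z) + t ^+ 2 * `|z| ^+ 2.
  have cv : (fun k => 2 * t * (ip (u k) z - f z) + t ^+ 2 * `|z| ^+ 2 +
      4^-1 * 8^-1 ^+ k) @ \oo -->
      2 * t * (ip y z - f z) + t ^+ 2 * `|z| ^+ 2 + 4^-1 * 0.
    apply: cvgD.
      apply: cvgD; last exact: cvg_cst.
      apply: cvgMr; apply: cvgB; last exact: cvg_cst.
      exact: cvg_ipl.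
    apply: cvgMr; apply: cvg_expr.
    by rewrite ger0_norm ?invr_ge0// invf_lt1 ?ltr1n.
  rewrite mulr0 addr0 in cv.
  apply: (cvgr_to_ge cv); apply: nearW => k.
  have := m_le (u k + t *: z); have := uP k.
  have fz : f (u k + t *: z) = f (u k) + t * f z by rewrite fD fZ.
  by rewrite /J fz -!ip_norm !(ipDl, ipDr, ipZl, ipZr) (ipC z) !ip_norm; lra.
have s0 := sqr_ge0 `|z|; have s1 : 0 < `|z| ^+ 2 + 1 by lra.
(* this t makes the quadratic in t negative unless its linear term vanishes *)
have := pert (- (ip y z - f z) / (`|z| ^+ 2 + 1)).
move: s0 s1; set A := ip y z - f z; set s := `|z| ^+ 2.
move=> s0 s1 h; apply/esym/eqP; rewrite (ipC z) -subr_eq0 -/A -sqrf_eq0 eq_le sqr_ge0.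
have hE : 2 * (- A / (s + 1)) * A + (- A / (s + 1)) ^+ 2 * s =
          - (A ^+ 2 * (s + 2)) / (s + 1) ^+ 2.
  by field; rewrite gt_eqF.
have h2 : A ^+ 2 * (s + 2) <= 0.
  by move: h; rewrite hE pmulr_lge0 ?invr_gt0 ?exprn_gt0// oppr_ge0.
by have := mulr_ge0 (sqr_ge0 A) s0; rewrite andbT; lra.
Qed.

End Riesz.

(** * Adjoints, coordinates and whitening *)

Section Adjoint.
Context (R : realType) d1 (T1 : measurableType d1) d2 (T2 : measurableType d2).
Variables (mu1 : {measure set T1 -> \bar R}) (mu2 : {measure set T2 -> \bar R}).
Variables (M N : nat).
Local Notation X := (vecL2 mu1 M).
Local Notation Y := (vecL2 mu2 N).

(** The noise W n is defined by duality, so its coordinates are controlled only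
    through vectors that represent the functionals z |-> <W z, x>. *)
Lemma adjoint_exists (W : {linear Y -> X}) : continuous W ->
  forall x, exists y, forall z, ip (W z) x = ip z y.
Proof.
move=> /linear_bounded_continuous/linear_boundedP/pinfty_ex_gt0[C _ WC] x.
apply: (@riesz _ _ _ _ _ (fun z => ip (W z) x) (C * `|x|)) => [a y z|y].
  by rewrite linearP ipDl ipZl.
rewrite (le_trans (ip_le_norm _ _))// mulrAC ler_wpM2r//; exact: WC.
Qed.

Lemma parseval (phi : nat -> X) : hilbert_basis phi -> forall v,
  (`|v| ^+ 2)%:E = (\sum_(0 <= l <oo) (ip v (phi l) ^+ 2)%:E)%E.
Proof.
move=> [_ phi_tot] v; apply/esym/cvg_lim => //.
have := cvg_ipl (FF := eventually_filter) (w := v) (phi_tot v).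
under eq_fun do rewrite ip_suml.
rewrite ip_norm => h; apply: cvg_EFin; first by apply: nearW => m; rewrite sumEFin.
rewrite (_ : fine \o _ = fun m => \sum_(l < m) ip (ip v (phi l) *: phi l) v).
  exact: h.
apply/funext => m /=; rewrite sumEFin/= big_mkord; apply: eq_bigr => l _.
by rewrite ipZl (ipC _ v) expr2.
Qed.

Lemma svd_coordinate (A : X -> Y) (sigma : nat -> R) phi psi :
    singular_value_decomposition A sigma phi psi ->
  forall v l, ip (A v) (psi l) = sigma l * ip v (phi l).
Proof.
case=> _ _ psi_on A_exp v l.
have h := cvg_ipl (FF := eventually_filter) (w := psi l) (A_exp v).
rewrite -(cvg_lim (@Rhausdorff R) h); apply: lim_near_cst => //; exists l.+1 => // m /= lm.
rewrite ip_suml (bigD1 (Ordinal lm))//= ipZl psi_on eqxx mulr1 big1 ?addr0//.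
move=> i il; rewrite ipZl psi_on [_ == _](_ : _ = false) ?mulr0//.
by apply/negbTE; apply: contra il => /eqP il; apply/eqP/val_inj.
Qed.

Lemma svd_singular_vector (A : X -> Y) (sigma : nat -> R) phi psi :
    singular_value_decomposition A sigma phi psi ->
  forall l, A (phi l) = sigma l *: psi l.
Proof.
case=> _ phi_on _ A_exp l.
rewrite -(cvg_lim (@norm_hausdorff _ Y) (A_exp (phi l))).
apply: lim_near_cst; first exact: norm_hausdorff.
exists l.+1 => // m /= lm.
rewrite (bigD1 (Ordinal lm))//= phi_on eqxx mulr1 big1 ?addr0//.
move=> i il; rewrite phi_on [_ == _](_ : _ = false) ?mulr0 ?scale0r//.
by apply/negbTE; apply: contra il => /eqP il; apply/eqP/val_inj.
Qed.

Lemma orthonormal_norm1 (phi : nat -> X) : orthonormal_seq phi ->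
  forall l, `|phi l| ^+ 2 = 1.
Proof. by move=> phi_on l; rewrite -ip_norm phi_on eqxx. Qed.

Lemma vec_eq_coordinates (phi : nat -> X) : hilbert_basis phi ->
  forall u v, (forall l, ip u (phi l) = ip v (phi l)) -> u = v.
Proof.
move=> phiP u v uv; apply/eqP; rewrite -subr_eq0 -normr_eq0 -sqrf_eq0.
rewrite -eqe (parseval phiP) eseries0// => l _ _.
by rewrite ipBl uv subrr expr0n.
Qed.

Section Whitening.
Variables (C S : Y -> Y).
Hypothesis SP : inverse_sqrt C S.

(** S is injective since C S S is the identity, and S (S (C (S y))) = S y. *)
Lemma isqrt_cov_isqrt y : S (C (S y)) = y.
Proof.
have S_inj : injective S.
  move=> u v uv.
  by rewrite -(inverse_sqrt_right SP u) uv inverse_sqrt_right.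
by apply: S_inj; rewrite (inverse_sqrt_left SP).
Qed.

(** Thus S (C y) is the whitened vector S^-1 y. *)
Lemma isqrt_whiten y : S (S (C y)) = y.
Proof. exact: inverse_sqrt_left SP y. Qed.

Lemma cov_whiten y : ip (C y) y = `|S (C y)| ^+ 2.
Proof.
rewrite -[X in ip _ X]isqrt_whiten -(inverse_sqrt_sym SP).
exact: ip_norm.
Qed.

End Whitening.

End Adjoint.

(** * The risk of a linear estimator *)

Section GaussianMoment.
Context (R : realType) d (Omega : measurableType d) (P : probability Omega R).

Lemma second_moment_shift (Z : {RV P >-> R}) (v c : R) :
    (Z : Omega -> R) \in Lfun P 2%:E -> ('E_P[Z] = 0)%E ->
    covariance P Z Z = v%:E ->
  (\int[P]_w ((c + Z w) ^+ 2)%:E = (c ^+ 2 + v)%:E)%E.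
Proof.
move=> Z2 EZ VZ.
have cZ2 : (cst c \+ Z) \in Lfun P 2%:E.
  by rewrite rpredD ?lee1n//= => _; rewrite Lfun_cst.
have EcZ : ('E_P[cst c \+ Z] = c%:E)%E.
  rewrite expectationD ?Lfun_cst// ?expectation_cst ?EZ ?adde0//.
  by rewrite Lfun_subset12 ?fin_num_measure.
have := varianceD_cst_l c Z2; rewrite [RHS]VZ varianceE// EcZ.
rewrite unlock => /(congr1 (fun x => x + c%:E ^+ 2)%E).
by rewrite subeK// -EFin_expe addrC => ->.
Qed.

End GaussianMoment.

Section RiskFormula.
Context (R : realType) d1 (T1 : measurableType d1) d2 (T2 : measurableType d2).
Variables (mu1 : {measure set T1 -> \bar R}) (mu2 : {measure set T2 -> \bar R}).
Variables (M N : nat).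
Local Notation X := (vecL2 mu1 M).
Local Notation Y := (vecL2 mu2 N).
Context d (Omega : measurableType d) (P : probability Omega R).
Variables (K : X -> Y) (C : Y -> Y) (n : Y -> {RV P >-> R}) (phi : nat -> X).
Hypotheses (n_noise : gaussian_process C n) (phiP : hilbert_basis phi).
Variables (W : Y -> X) (y : nat -> Y).
Hypothesis Wy : forall l z, ip (W z) (phi l) = ip z (y l).

(** By Parseval the error splits into coordinates, and in coordinate l the
    deterministic part is shifted by the centred variable n (y l). *)
Lemma mean_square_error (xi : Omega -> X) (b : X) : noise_image n W xi ->
  (\int[P]_w (`|b + xi w| ^+ 2)%:E =
   \sum_(0 <= l <oo) (ip b (phi l) ^+ 2 + ip (C (y l)) (y l))%:E)%E.
Proof.
move=> [xi_meas xi_n].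
have mb l : measurable_fun [set: Omega]
    (fun w => (((ip b (phi l) + ip (xi w) (phi l)) ^+ 2)%:E)).
  apply/measurable_EFinP; apply: measurable_funX.
  by apply: measurable_funD => //; exact: xi_meas.
under eq_integral => w _.
  rewrite (parseval phiP); under eq_eseriesr do rewrite ipDl; over.
rewrite integral_nneseries//; last by move=> l w _; rewrite lee_fin sqr_ge0.
apply: eq_eseriesr => l _.
rewrite -(second_moment_shift _ (process_L2 n_noise (y l))
  (process_mean n_noise _) (process_cov n_noise _ _)).
apply: ge0_ae_eq_integral => //.
- apply/measurable_EFinP; apply: measurable_funX.
  exact: measurable_funD.
- by move=> w _; rewrite lee_fin sqr_ge0.
- by move=> w _; rewrite lee_fin sqr_ge0.
have := xi_n (phi l) (y l) (Wy l).
by apply: filterS => w + _ => ->.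
Qed.

(** All versions of W n have the same mean square error, and the infimum over
    no version at all is +oo. *)
Lemma risk_ge (v : X) :
  (\sum_(0 <= l <oo)
     (ip (W (K v) - v) (phi l) ^+ 2 + ip (C (y l)) (y l))%:E <= risk K n W v)%E.
Proof.
apply: le_ereal_inf_tmp => _ [xi xiP <-].
rewrite -(mean_square_error _ xiP); under eq_integral do rewrite addrAC.
exact: lexx.
Qed.

Lemma risk_le (v : X) : (exists xi, noise_image n W xi) ->
  (risk K n W v <= \sum_(0 <= l <oo)
     (ip (W (K v) - v) (phi l) ^+ 2 + ip (C (y l)) (y l))%:E)%E.
Proof.
move=> [xi xiP]; apply: ereal_inf_lbound; exists xi => //.
rewrite -(mean_square_error _ xiP).
by under eq_integral do rewrite addrAC.
Qed.

End RiskFormula.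

(** * The equation for kappa *)

Lemma eseries_finite_support (R : realType) (f : nat -> R) (m : nat) :
    (forall l, (m <= l)%N -> f l = 0) ->
  (\sum_(0 <= l <oo) (f l)%:E = (\sum_(l < m) f l)%:E)%E.
Proof.
move=> f0; apply: lim_near_cst => //; exists m => // k /= mk.
rewrite sumEFin (big_cat_nat (n := m))//= [X in _ + X]big_nat_cond.
by rewrite [X in _ + X]big1 ?addr0 ?big_mkord// => l /andP[/andP[/f0->]].
Qed.

Section Kappa.
Variables (R : realType) (sigma a : nat -> R) (Q : R).
Hypotheses (sigma_gt0 : forall l, 0 < sigma l) (a_gt0 : forall l, 0 < a l).
Hypotheses (a_infty : a @ \oo --> +oo) (Q_gt0 : 0 < Q).

Definition weight (kappa : R) (l : nat) : R := Num.max (1 - kappa * a l) 0.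

Lemma weight_ge0 kappa l : 0 <= weight kappa l.
Proof. by rewrite le_max lexx orbT. Qed.

Lemma weight_lt1 kappa l : 0 < kappa -> weight kappa l < 1.
Proof. by move=> k0; rewrite gt_max ltr01 andbT ltrBlDr ltrDl mulr_gt0. Qed.

Lemma weight_ge kappa l : 1 - kappa * a l <= weight kappa l.
Proof. by rewrite le_max lexx. Qed.

(** Where the weight is positive, its complement is exactly kappa a_l. *)
Lemma weight_complement kappa l :
  weight kappa l * (1 - weight kappa l) = kappa * a l * weight kappa l.
Proof.
by rewrite /weight; case: leP => _; [rewrite !(mul0r, mulr0)|ring].
Qed.

Lemma weight_nonincreasing kappa kappa' l :
  kappa <= kappa' -> weight kappa' l <= weight kappa l.
Proof.
move=> kk'; rewrite ge_max weight_ge0 andbT (le_trans _ (weight_ge _ _))//.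
by rewrite lerB// ler_wpM2r// ltW.
Qed.

(** The rank bound m is uniform in kappa >= kappa0, which makes the equation
    for kappa an equation between continuous functions near any positive kappa. *)
Lemma weight_finite_support kappa0 : 0 < kappa0 ->
  exists m, forall kappa l, kappa0 <= kappa -> (m <= l)%N -> weight kappa l = 0.
Proof.
move=> k0; have /cvgryPge/(_ kappa0^-1)[m _ am] := a_infty.
exists m => kappa l kk ml; apply/max_idPr; rewrite subr_le0.
have := am l ml; rewrite -[_ <= a l](ler_pM2l k0) mulfV ?gt_eqF//.
by move=> /le_trans; apply; rewrite ler_wpM2r// ltW.
Qed.

Lemma slope_gt0 l : 0 < a l / sigma l ^+ 2.
Proof. by rewrite divr_gt0// exprn_gt0. Qed.

Lemma slope_weight_ge0 kappa l : 0 <= a l / sigma l ^+ 2 * weight kappa l.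
Proof. by rewrite mulr_ge0 ?weight_ge0// ltW// slope_gt0. Qed.

Lemma kappa_equation_finite kappa m :
    (forall l, (m <= l)%N -> weight kappa l = 0) ->
  kappa_equation sigma a Q kappa <->
  kappa * Q = \sum_(l < m) a l / sigma l ^+ 2 * weight kappa l.
Proof.
move=> w0; rewrite /kappa_equation -/weight.
rewrite (@eseries_finite_support _
  (fun l => a l / sigma l ^+ 2 * weight kappa l) m).
  rewrite -EFinB; split => [[]/eqP|->]; first by rewrite subr_eq0 => /eqP.
  by rewrite subrr.
by move=> l ml; rewrite w0// mulr0.
Qed.

(** For kappa <= 0 the product kappa Q is at most 0, while the series is positive,
    possibly infinite. *)
Lemma kappa_equation_gt0 kappa : kappa_equation sigma a Q kappa -> 0 < kappa.
Proof.
rewrite /kappa_equation => eqk; rewrite ltNge; apply/negP => k0.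
suff : ((kappa * Q)%:E < \sum_(0 <= l <oo)
     (a l / sigma l ^+ 2 * weight kappa l)%:E)%E.
  move/eqP : eqk; rewrite sube_eq ?fin_num_adde_defr// add0e => /eqP->.
  by rewrite ltxx.
apply: (@le_lt_trans _ _ 0%E).
  by rewrite lee_fin mulr_le0_ge0// ltW.
rewrite (@nneseriesD1 _ _ 0%N xpredT)//; last first.
  by move=> l _; rewrite lee_fin slope_weight_ge0.
apply: lt_le_trans (leeDl _ _); last first.
  by apply: nneseries_ge0 => l _ _; rewrite lee_fin slope_weight_ge0.
rewrite lte_fin mulr_gt0 ?slope_gt0//.
rewrite (lt_le_trans _ (weight_ge _ _))// subr_gt0 (le_lt_trans _ ltr01)//.
by rewrite mulr_le0_ge0// ltW.
Qed.

(** kappa Q increases strictly and the series is nonincreasing in kappa. *)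
Lemma kappa_equation_unique kappa kappa' :
    kappa_equation sigma a Q kappa -> kappa_equation sigma a Q kappa' ->
  kappa' = kappa.
Proof.
wlog kk' : kappa kappa' / kappa <= kappa'.
  move=> H h h'; have [/H->//|/ltW/H->//] := leP kappa kappa'.
move=> h h'; apply/eqP; rewrite eq_le kk' andbT.
have k0 := kappa_equation_gt0 h.
have [m w0] := weight_finite_support k0.
move/kappa_equation_finite : h => /(_ m (fun l => w0 _ _ (lexx kappa))) h.
move/kappa_equation_finite : h' => /(_ m (fun l => w0 _ _ kk')) h'.
rewrite -(ler_pM2r Q_gt0) h h'; apply: ler_sum => l _.
by rewrite ler_wpM2l ?weight_nonincreasing// ltW// slope_gt0.
Qed.

(** The intermediate value theorem on [k0, k1], where k0 is so small that the
    first summand alone exceeds k0 Q, and k1 Q dominates the sum of the slopes. *)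
Lemma kappa_equation_exists : exists kappa, kappa_equation sigma a Q kappa.
Proof.
pose s l := a l / sigma l ^+ 2.
pose k0 := s 0%N / (2 * (Q + s 0%N * a 0%N)).
have s0 l : 0 < s l by exact: slope_gt0.
have den0 : 0 < 2 * (Q + s 0%N * a 0%N) by rewrite mulr_gt0// addr_gt0// mulr_gt0.
have k0_gt0 : 0 < k0 by rewrite divr_gt0.
have [m w0] := weight_finite_support k0_gt0.
pose S kappa := \sum_(l < m.+1) s l * weight kappa l.
pose k1 := Num.max k0 ((\sum_(l < m.+1) s l) / Q).
have w0S kappa : k0 <= kappa -> forall l, (m.+1 <= l)%N -> weight kappa l = 0.
  by move=> kk l /ltnW; exact: w0.
have k01 : k0 <= k1 by rewrite le_max lexx.
pose F kappa : R := kappa * Q - S kappa.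
have cw l : continuous (weight ^~ l : R -> R).
  move=> z; rewrite (_ : weight ^~ l = (fun k => 1 - k * a l) \max cst 0)//.
  apply: (@continuous_max R R); last exact: cvg_cst.
  by apply: cvgB; [exact: cvg_cst|apply: cvgMl; exact: cvg_id].
have cF : continuous F.
  move=> x; apply: cvgB; first by apply: cvgMl; exact: cvg_id.
  apply: (@continuous_big _ _ _ _ _ (@add_continuous R)) => l _ z.
  by apply: cvgMr; exact: cw.
have F0 : F k0 <= 0.
  rewrite subr_le0 /S big_ord_recl/=.
  rewrite -[leLHS]addr0 lerD//; last first.
    by apply: sumr_ge0 => l _; rewrite mulr_ge0 ?weight_ge0// ltW.
  apply: (@le_trans _ _ (s 0%N * (1 - k0 * a 0%N))); last first.
    by rewrite ler_wpM2l ?weight_ge// ltW.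
  suff : k0 * (Q + s 0%N * a 0%N) <= s 0%N.
    by rewrite mulrDr mulrBr mulr1 lerBrDr [s 0%N * (k0 * _)]mulrCA.
  have -> : k0 * (Q + s 0%N * a 0%N) = s 0%N / 2.
    by rewrite /k0; field; rewrite gt_eqF// addr_gt0// mulr_gt0.
  by have := s0 0%N; lra.
have F1 : 0 <= F k1.
  rewrite subr_ge0 (@le_trans _ _ (\sum_(l < m.+1) s l))//.
    apply: ler_sum => l _; rewrite -[leRHS]mulr1 ler_wpM2l ?ltW//.
    by rewrite weight_lt1// (lt_le_trans k0_gt0).
  by rewrite -ler_pdivrMr// le_max lexx orbT.
have [||kappa] := @IVT R F k0 k1 0 k01.
- exact: continuous_subspaceT.
- by rewrite ge_min F0/= le_max F1 orbT.
rewrite in_itv/= => /andP[kk _] Fk; exists kappa.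
apply/(@kappa_equation_finite _ m.+1); first exact: w0S.
by apply/eqP; rewrite -subr_eq0; apply/eqP.
Qed.

End Kappa.

(** * Finite-rank estimators *)

Section FiniteRank.
Context (R : realType) d1 (T1 : measurableType d1) d2 (T2 : measurableType d2).
Variables (mu1 : {measure set T1 -> \bar R}) (mu2 : {measure set T2 -> \bar R}).
Variables (M N : nat).
Local Notation X := (vecL2 mu1 M).
Local Notation Y := (vecL2 mu2 N).

Definition finite_rank (m : nat) (y : nat -> Y) (phi : nat -> X) (z : Y) : X :=
  \sum_(l < m) ip z (y l) *: phi l.

Section Instance.
Variables (m : nat) (y : nat -> Y) (phi : nat -> X).

Let finite_rank_linear : linear (finite_rank m y phi).
Proof.
move=> c u v; rewrite /finite_rank scaler_sumr -big_split/=.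
by apply: eq_bigr => l _; rewrite ipDl ipZl scalerDl scalerA.
Qed.

HB.instance Definition _ :=
  GRing.isLinear.Build R Y X *:%R (finite_rank m y phi) finite_rank_linear.

Lemma finite_rank_continuous : continuous (finite_rank m y phi).
Proof.
apply: (@continuous_big _ _ _ _ _ (@add_continuous X)) => l _ z.
exact: (cvgZr_tmp (cvg_ipl (FF := nbhs_pfilter z) cvg_id)).
Qed.

Lemma ip_finite_rank z x :
  ip (finite_rank m y phi z) x = \sum_(l < m) ip z (y l) * ip (phi l) x.
Proof. by rewrite ip_suml; apply: eq_bigr => l _; rewrite ipZl. Qed.

Lemma finite_rank_coordinate : orthonormal_seq phi ->
    (forall l, (m <= l)%N -> y l = 0) ->
  forall l z, ip (finite_rank m y phi z) (phi l) = ip z (y l).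
Proof.
move=> phi_on y0 l z; rewrite ip_finite_rank; have [lm|ml] := ltnP l m.
  rewrite (bigD1 (Ordinal lm))//= phi_on eqxx mulr1 big1 ?addr0//.
  move=> i il; rewrite phi_on [_ == _](_ : _ = false) ?mulr0//.
  by apply/negbTE; apply: contra il => /eqP il; apply/eqP/val_inj.
rewrite y0// ipC ip0l big1// => i _; rewrite phi_on [_ == _](_ : _ = false) ?mulr0//.
by apply/negbTE; rewrite neq_ltn (leq_trans _ ml).
Qed.

End Instance.

Context d (Omega : measurableType d) (P : probability Omega R).
Variables (C : Y -> Y) (n : Y -> {RV P >-> R}).
Hypothesis n_noise : gaussian_process C n.

Lemma process_sum (y : nat -> Y) (c : nat -> R) (m : nat) :
  {ae P, forall w, n (\sum_(l < m) c l *: y l) w = \sum_(l < m) c l * n (y l) w}.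
Proof.
elim: m => [|m ih].
  rewrite big_ord0; have := process_linear n_noise 1 0 0.
  apply: filterS => w; rewrite scale1r addr0 mul1r big_ord0 => h.
  by apply: (addrI (n 0 w)); rewrite -h addr0.
have := process_linear n_noise (c m) (y m) (\sum_(l < m) c l *: y l).
apply: filterS2 ih => w ih; rewrite !big_ord_recr/= addrC => ->.
by rewrite ih addrC.
Qed.

(** The noise image is the finite combination of the phi_l with the coefficients
    n (y l); linearity of n identifies its pairings. *)
Lemma finite_rank_noise_image (m : nat) (y : nat -> Y) (phi : nat -> X) :
  exists xi, noise_image n (finite_rank m y phi) xi.
Proof.
exists (fun w => \sum_(l < m) n (y l) w *: phi l); split=> [x|x y' Wxy].
  under eq_fun do rewrite ip_suml.
  apply: measurable_sum => l; under eq_fun do rewrite ipZl.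
  exact: measurable_funM.
have -> : y' = \sum_(l < m) ip (phi l) x *: y l.
  apply: ip_inj => z; rewrite ip_suml ipC -Wxy ip_finite_rank.
  by apply: eq_bigr => l _; rewrite ipZl (ipC (y l)) mulrC.
have := process_sum y (fun l => ip (phi l) x) m.
apply: filterS => w ->; rewrite ip_suml; apply: eq_bigr => l _.
by rewrite ipZl mulrC.
Qed.

End FiniteRank.

Section SignChoice.
Context (R : realType) d1 (T1 : measurableType d1).
Variables (mu1 : {measure set T1 -> \bar R}) (M : nat).
Local Notation X := (vecL2 mu1 M).

(** Choosing the signs one after the other so that each new cross term in
    |D u|^2 is nonnegative makes u at least as bad as the average over all sign
    patterns, which is the diagonal sum on the left. *)
Lemma sign_choice (D : X -> X) (phi : nat -> X) (t : nat -> R) (m : nat) :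
    (forall c u v, D (c *: u + v) = c *: D u + D v) ->
    orthonormal_seq phi ->
  exists u, (forall l, ip u (phi l) ^+ 2 = if (l < m)%N then t l ^+ 2 else 0) /\
    \sum_(l < m) t l ^+ 2 * `|D (phi l)| ^+ 2 <= `|D u| ^+ 2.
Proof.
move=> D_lin phi_on; elim: m => [|m [u [uP Du]]].
  exists 0; split=> [l|]; first by rewrite ip0l expr0n.
  by rewrite big_ord0 sqr_ge0.
pose e : R := if 0 <= t m * ip (D (phi m)) (D u) then 1 else -1.
have e2 : e ^+ 2 = 1 by rewrite /e; case: ifP => _; rewrite ?sqrrN expr1n.
have e_ge0 : 0 <= e * (t m * ip (D (phi m)) (D u)).
  rewrite /e; case: ifP => [|/negbT]; first by rewrite mul1r.
  by rewrite -ltNge mulN1r oppr_ge0 => /ltW.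
exists ((e * t m) *: phi m + u); split=> [l|].
  rewrite ipDl ipZl phi_on ltnS leq_eqVlt; have [<-|lm] := eqVneq m l.
    have := uP m; rewrite ltnn => /eqP; rewrite sqrf_eq0 => /eqP->.
    by rewrite /= mulr1 addr0 exprMn e2 mul1r.
  by rewrite /= mulr0 add0r uP.
have sq : `|D ((e * t m) *: phi m + u)| ^+ 2 = t m ^+ 2 * `|D (phi m)| ^+ 2 +
    2 * (e * (t m * ip (D (phi m)) (D u))) + `|D u| ^+ 2.
  rewrite D_lin -!ip_norm !(ipDl, ipDr, ipZl, ipZr) (ipC (D u)).
  have -> : t m ^+ 2 = e ^+ 2 * t m ^+ 2 by rewrite e2 mul1r.
  ring.
by rewrite big_ord_recr/= sq; lra.
Qed.

End SignChoice.

(** * Minimaxity of the filter *)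

Section Minimax.
Context (R : realType) d1 (T1 : measurableType d1) d2 (T2 : measurableType d2).
Variables (mu1 : {measure set T1 -> \bar R}) (mu2 : {measure set T2 -> \bar R}).
Variables (M N : nat).
Local Notation X := (vecL2 mu1 M).
Local Notation Y := (vecL2 mu2 N).
Context d (Omega : measurableType d) (P : probability Omega R).
Variables (K : {linear X -> Y}) (C S : {linear Y -> Y}) (n : Y -> {RV P >-> R}).
Hypotheses (n_noise : gaussian_process C n) (SP : inverse_sqrt C S).
Variables (sigma : nat -> R) (phi : nat -> X) (psi : nat -> Y).
Hypothesis svd : singular_value_decomposition (S \o K) sigma phi psi.
Hypothesis phiP : hilbert_basis phi.
Variables (a : nat -> R) (Q kappa : R) (m : nat).
Hypotheses (a_gt0 : forall l, 0 < a l) (kappa_gt0 : 0 < kappa).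
Local Notation lambda := (weight a kappa).
Hypothesis lambda0 : forall l, (m <= l)%N -> lambda l = 0.
Hypothesis kappaQ : kappa * Q = \sum_(l < m) a l / sigma l ^+ 2 * lambda l.
Local Notation Theta := (ellipsoid phi a Q).
Let V := \sum_(l < m) lambda l / sigma l ^+ 2.

Definition filter_adjoint (l : nat) : Y := (lambda l / sigma l) *: S (psi l).

Definition filter_estimator : {linear Y -> X} := finite_rank m filter_adjoint phi.

Let sigma_gt0 l : 0 < sigma l. Proof. exact: svd_gt0 svd l. Qed.
Let sigma_neq0 l : sigma l != 0. Proof. by rewrite gt_eqF. Qed.
Let phi_on : orthonormal_seq phi. Proof. exact: svd_right svd. Qed.
Let psi_on : orthonormal_seq psi. Proof. exact: svd_left svd. Qed.

Lemma filter_adjoint0 l : (m <= l)%N -> filter_adjoint l = 0.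
Proof. by move=> ml; rewrite /filter_adjoint lambda0// mul0r scale0r. Qed.

Lemma filter_coordinate l z :
  ip (filter_estimator z) (phi l) = ip z (filter_adjoint l).
Proof. exact: (finite_rank_coordinate phi_on filter_adjoint0). Qed.

Lemma ip_filter_adjoint l z :
  ip z (filter_adjoint l) = lambda l / sigma l * ip (S z) (psi l).
Proof. by rewrite ipZr (inverse_sqrt_sym SP). Qed.

Lemma whiten_filter_adjoint l :
  S (C (filter_adjoint l)) = (lambda l / sigma l) *: psi l.
Proof. by rewrite !linearZ/= (isqrt_cov_isqrt SP). Qed.

Lemma filter_signal l v :
  ip (filter_estimator (K v)) (phi l) = lambda l * ip v (phi l).
Proof.
rewrite filter_coordinate ip_filter_adjoint.
rewrite [ip (S (K v)) _](svd_coordinate svd) mulrA.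
by rewrite divfK.
Qed.

Lemma filter_noise l :
  ip (C (filter_adjoint l)) (filter_adjoint l) = (lambda l / sigma l) ^+ 2.
Proof.
rewrite (cov_whiten SP) whiten_filter_adjoint normrZ exprMn.
by rewrite (orthonormal_norm1 psi_on) mulr1 real_normK// num_real.
Qed.

Lemma filter_series tau :
  (fun k => \sum_(l < k) (lambda l / sigma l * ip (S tau) (psi l)) *: phi l)
    @ \oo --> filter_estimator tau.
Proof.
apply: cvg_near_cst; exists m => // k /= mk.
rewrite -(big_mkord xpredT (fun l => (lambda l / sigma l * ip (S tau) (psi l)) *: phi l)).
rewrite (big_cat_nat (n := m))//= [X in _ + X]big_nat_cond.
rewrite [X in _ + X]big1 ?addr0 ?big_mkord.
  by apply: eq_bigr => l _; rewrite ip_filter_adjoint.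
by move=> l /andP[/andP[ml _] _]; rewrite lambda0// !mul0r scale0r.
Qed.

(** Here the equation for kappa enters: kappa^2 Q is the sum of
    (1 - lambda l) lambda l / sigma_l^2. *)
Lemma valueE : kappa ^+ 2 * Q + \sum_(l < m) (lambda l / sigma l) ^+ 2 = V.
Proof.
rewrite expr2 -mulrA kappaQ mulr_sumr -big_split/=; apply: eq_bigr => l _.
have -> : kappa * (a l / sigma l ^+ 2 * lambda l) =
    kappa * a l * lambda l / sigma l ^+ 2 by rewrite !mulrA mulrAC.
rewrite -weight_complement expr_div_n -mulrDl; congr (_ / _); ring.
Qed.

(** The bias is at most kappa^2 Q because 1 - lambda l <= kappa a_l; the variance
    does not depend on the signal, and valueE adds the two up. *)
Lemma max_risk_filter : (max_risk K n filter_estimator Theta <= V%:E)%E.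
Proof.
apply: ge_ereal_sup => _ [v vQ <-].
have noise := finite_rank_noise_image n_noise m filter_adjoint phi.
apply: le_trans (risk_le K n_noise phiP filter_coordinate v noise) _.
rewrite -valueE EFinD.
have -> : (\sum_(l < m) (lambda l / sigma l) ^+ 2)%:E =
    (\sum_(0 <= l <oo) ((lambda l / sigma l) ^+ 2)%:E)%E.
  by rewrite (@eseries_finite_support _ _ m)// => l /lambda0->; rewrite mul0r expr0n.
apply: (@le_trans _ _ ((kappa ^+ 2)%:E * (\sum_(0 <= l <oo)
    (a l ^+ 2 * ip v (phi l) ^+ 2)%:E) +
    (\sum_(0 <= l <oo) ((lambda l / sigma l) ^+ 2)%:E))%E); last first.
  by rewrite (EFinM (kappa ^+ 2)) leeD2r// lee_pmul2l ?lte_fin ?exprn_gt0.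
have sq0 l : (0 <= (a l ^+ 2 * ip v (phi l) ^+ 2)%:E)%E.
  by rewrite lee_fin mulr_ge0// sqr_ge0.
rewrite -nneseriesZl//.
rewrite -nneseriesD//; last 2 first.
- by move=> l _ _; rewrite mule_ge0// lee_fin sqr_ge0.
- by move=> l _ _; rewrite lee_fin sqr_ge0.
apply: lee_nneseries => [l _ _|l _].
  by rewrite lee_fin filter_noise addr_ge0 ?sqr_ge0.
rewrite filter_noise -EFinM -EFinD lee_fin lerD2r ipBl filter_signal.
rewrite -[X in _ - X]mul1r -mulrBl exprMn (mulrA (kappa ^+ 2)) ler_wpM2r ?sqr_ge0//.
rewrite -exprMn -sqrrN opprB ler_pXn2r// ?nnegrE ?subr_ge0.
- by rewrite lerBlDr -lerBlDl weight_ge.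
- exact/ltW/weight_lt1.
- by rewrite mulr_ge0// ltW.
Qed.

Section LowerBound.
Variable W : {linear Y -> X}.
Variable y : nat -> Y.
Hypothesis Wy : forall l z, ip (W z) (phi l) = ip z (y l).

Let D x := W (K x) - x.

Let D_lin c u v : D (c *: u + v) = c *: D u + D v.
Proof.
rewrite /D.
have -> : W (K (c *: u + v)) = c *: W (K u) + W (K v) by rewrite !linearP.
by rewrite scalerBr opprD addrACA.
Qed.

(** Squared coordinates of a least favourable signal; they turn lambda l into
    the minimizer of t |-> c (1 - t)^2 + t^2 / sigma^2. *)
Let c l : R := lambda l / (sigma l ^+ 2 * (1 - lambda l)).

Let c_ge0 l : 0 <= c l.
Proof.
rewrite divr_ge0 ?weight_ge0// mulr_ge0 ?sqr_ge0// subr_ge0.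
exact/ltW/weight_lt1.
Qed.

Let c_slope l : kappa * a l * c l = lambda l / sigma l ^+ 2.
Proof.
have [l0|ln0] := eqVneq (lambda l) 0; first by rewrite /c l0 !mul0r mulr0.
have /(mulfI ln0) w : lambda l * (1 - lambda l) = lambda l * (kappa * a l).
  by rewrite weight_complement mulrC.
by rewrite /c w; field; rewrite sigma_neq0 !gt_eqF.
Qed.

Let c0 l : (m <= l)%N -> c l = 0.
Proof. by move=> ml; rewrite /c lambda0// mul0r. Qed.

(** The least favourable signals are on the boundary of the ellipsoid. *)
Let c_ellipsoid : \sum_(l < m) a l ^+ 2 * c l = Q.
Proof.
apply: (mulfI (lt0r_neq0 kappa_gt0)); rewrite kappaQ mulr_sumr.
apply: eq_bigr => l _.
have -> : kappa * (a l ^+ 2 * c l) = a l * (kappa * a l * c l) by ring.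
by rewrite c_slope; ring.
Qed.

(** With z the whitened adjoint and p = <z, psi_l>, the bias of W at phi_l is at
    least (sigma_l p - 1)^2, and the two sides then differ by
    c (sigma_l p - lambda l)^2. *)
Let coordinate_bound l : lambda l / sigma l ^+ 2 +
    `|S (C (y l)) - (lambda l / sigma l) *: psi l| ^+ 2 <=
  c l * `|D (phi l)| ^+ 2 + `|S (C (y l))| ^+ 2.
Proof.
set z := S (C (y l)); pose p := ip z (psi l).
have Dp : ip (D (phi l)) (phi l) = sigma l * p - 1.
  rewrite ipBl phi_on eqxx Wy -(isqrt_whiten SP (y l)) -(inverse_sqrt_sym SP).
  by rewrite [S (K _)](svd_singular_vector svd) ipZl ipC.
have D_ge : (sigma l * p - 1) ^+ 2 <= `|D (phi l)| ^+ 2.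
  rewrite -Dp -ip_norm (le_trans (ip_cauchy_schwarz _ _))//.
  by rewrite phi_on eqxx mulr1.
have -> : `|z - (lambda l / sigma l) *: psi l| ^+ 2 =
    `|z| ^+ 2 - 2 * (lambda l / sigma l) * p + (lambda l / sigma l) ^+ 2.
  rewrite -!ip_norm !(ipBl, ipBr, ipZl, ipZr) psi_on eqxx (ipC (psi l)) -/p mulr1.
  ring.
apply: (@le_trans _ _ (c l * (sigma l * p - 1) ^+ 2 + `|z| ^+ 2)); last first.
  by rewrite lerD2r ler_wpM2l.
rewrite -subr_ge0.
suff -> : c l * (sigma l * p - 1) ^+ 2 + `|z| ^+ 2 - (lambda l / sigma l ^+ 2 +
   (`|z| ^+ 2 - 2 * (lambda l / sigma l) * p + (lambda l / sigma l) ^+ 2)) =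
   c l * (sigma l * p - lambda l) ^+ 2 by rewrite mulr_ge0// sqr_ge0.
have w1 : 1 - lambda l != 0 by rewrite gt_eqF// subr_gt0 weight_lt1.
by rewrite /c; field; rewrite w1 sigma_neq0.
Qed.

(** The risk at a least favourable signal with well-chosen signs; the second
    summand measures how far W is from the filter. *)
Lemma max_risk_lower_bound :
  (\sum_(0 <= l <oo) (lambda l / sigma l ^+ 2 +
     `|S (C (y l)) - (lambda l / sigma l) *: psi l| ^+ 2)%:E
   <= max_risk K n W Theta)%E.
Proof.
have [u [u_coord Du]] := sign_choice (fun l => Num.sqrt (c l)) m D_lin phi_on.
have uQ : Theta u.
  rewrite /ellipsoid/= (@eseries_finite_support _ _ m) => [|l ml].
    rewrite lee_fin -c_ellipsoid le_eqVlt; apply/orP; left; apply/eqP.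
    by apply: eq_bigr => l _; rewrite u_coord ltn_ord sqr_sqrtr.
  by rewrite u_coord ltnNge ml mulr0.
apply: le_trans (ereal_sup_ubound _); last by exists u.
apply: le_trans (risk_ge K n_noise phiP Wy u).
under [leRHS]eq_eseriesr do rewrite EFinD.
rewrite nneseriesD; last 2 first.
- by move=> l _ _; rewrite lee_fin sqr_ge0.
- by move=> l _ _; rewrite (cov_whiten SP) lee_fin sqr_ge0.
rewrite -(parseval phiP).
apply: (@le_trans _ _ (\sum_(0 <= l <oo) (c l * `|D (phi l)| ^+ 2)%:E +
   \sum_(0 <= l <oo) (ip (C (y l)) (y l))%:E)%E).
  rewrite -nneseriesD; last 2 first.
  - by move=> l _ _; rewrite lee_fin mulr_ge0// sqr_ge0.
  - by move=> l _ _; rewrite (cov_whiten SP) lee_fin sqr_ge0.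
  apply: lee_nneseries => [l _ _|l _].
    rewrite lee_fin addr_ge0 ?sqr_ge0// divr_ge0 ?sqr_ge0//.
    exact: weight_ge0.
  by rewrite -EFinD lee_fin (cov_whiten SP) coordinate_bound.
rewrite leeD2r// (@eseries_finite_support _ _ m) => [|l ml]; last first.
  by rewrite c0// mul0r.
rewrite lee_fin; apply: le_trans Du; apply: ler_sum => l _.
by rewrite (sqr_sqrtr (c_ge0 l)).
Qed.

End LowerBound.

Lemma value_series : V%:E = (\sum_(0 <= l <oo) (lambda l / sigma l ^+ 2)%:E)%E.
Proof.
by rewrite (@eseries_finite_support _ _ m)// => l /lambda0->; rewrite mul0r.
Qed.

Let value_ge0 l : 0 <= lambda l / sigma l ^+ 2.
Proof. by rewrite divr_ge0 ?sqr_ge0// weight_ge0. Qed.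

Lemma max_risk_ge (W : {linear Y -> X}) : continuous W ->
  exists2 y : nat -> Y, forall l z, ip (W z) (phi l) = ip z (y l) &
  (V%:E + \sum_(0 <= l <oo)
     (`|S (C (y l)) - (lambda l / sigma l) *: psi l| ^+ 2)%:E
   <= max_risk K n W Theta)%E.
Proof.
move=> Wc; have [y Wy] := choice (fun l => adjoint_exists Wc (phi l)).
exists y => //; apply: le_trans (max_risk_lower_bound Wy).
rewrite value_series -nneseriesD// => l _ _.
by rewrite lee_fin value_ge0.
Qed.

Lemma minimax_linear_riskE : minimax_linear_risk K n Theta = V%:E.
Proof.
apply/eqP; rewrite eq_le; apply/andP; split.
  apply: ge_ereal_inf; exists (max_risk K n filter_estimator Theta).
    by exists filter_estimator => //; exact: finite_rank_continuous.
  exact: max_risk_filter.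
apply: le_ereal_inf_tmp => _ [W Wc <-].
have [y _] := max_risk_ge Wc; apply: le_trans; rewrite leeDl//.
by apply: nneseries_ge0 => l _ _; rewrite lee_fin sqr_ge0.
Qed.

Lemma filter_minimax : minimax_linear_estimator K n filter_estimator Theta.
Proof.
have Wc : continuous filter_estimator by exact: finite_rank_continuous.
split=> //; rewrite minimax_linear_riskE; apply/eqP; rewrite eq_le max_risk_filter.
rewrite -minimax_linear_riskE; apply: ereal_inf_lbound.
by exists filter_estimator.
Qed.

(** Attaining the value forces every summand of the gap to vanish, so that W has
    the whitened adjoint vectors of the filter. *)
Lemma minimax_unique (W : {linear Y -> X}) :
  minimax_linear_estimator K n W Theta -> W =1 filter_estimator.
Proof.
move=> [Wc Wrisk] z; have [y Wy] := max_risk_ge Wc.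
rewrite Wrisk minimax_linear_riskE -[leRHS]adde0 leeD2lE// => gap.
apply: (vec_eq_coordinates phiP) => l; rewrite Wy filter_coordinate.
congr ip; rewrite -(isqrt_whiten SP (y l)).
suff -> : S (C (y l)) = (lambda l / sigma l) *: psi l by rewrite linearZ.
apply/eqP; rewrite -subr_eq0 -normr_eq0 -sqrf_eq0 eq_le sqr_ge0 andbT.
rewrite -lee_fin; apply: le_trans gap.
rewrite (@nneseriesD1 _ _ l xpredT)// leeDl//.
by apply: nneseries_ge0 => k _ _; rewrite lee_fin sqr_ge0.
Qed.

End Minimax.

Theorem theorem4p2 (R : realType) (Nz Na : nat)
    (Nz_gt0 : (0 < Nz)%N) (Na_gt0 : (0 < Na)%N)
    (K : {linear L2square R (3 * Nz)%N -> L2square R Na})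
    (K_conv : convolution_operator K)
    (K_compact : compact_operator K)
    (d : measure_display) (Omega : measurableType d) (P : probability Omega R)
    (Cov : {linear L2square R Na -> L2square R Na})
    (Cov_cont : continuous Cov)
    (Cov_pos : strictly_positive_definite Cov)
    (n : L2square R Na -> {RV P >-> R})
    (n_noise : gaussian_process Cov n)
    (Cov_isqrt : {linear L2square R Na -> L2square R Na})
    (Cov_isqrt_cont : continuous Cov_isqrt)
    (Cov_isqrtP : inverse_sqrt Cov Cov_isqrt)
    (sigma : nat -> R) (phi : nat -> L2square R (3 * Nz)%N)
    (psi : nat -> L2square R Na)
    (svd : singular_value_decomposition (Cov_isqrt \o K) sigma phi psi)
    (phi_basis : hilbert_basis phi)
    (a : nat -> R) (a_gt0 : forall l, 0 < a l) (a_infty : a @ \oo --> +oo)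
    (Q : R) (Q_gt0 : 0 < Q) :
  exists (kappa : R) (W : {linear L2square R Na -> L2square R (3 * Nz)%N}),
    let lambda l := Num.max (1 - kappa * a l) 0 in
    [/\ [/\ 0 < kappa, kappa_equation sigma a Q kappa &
            forall kappa', kappa_equation sigma a Q kappa' -> kappa' = kappa],
        minimax_linear_estimator K n W (ellipsoid phi a Q),
        forall W' : {linear L2square R Na -> L2square R (3 * Nz)%N},
          minimax_linear_estimator K n W' (ellipsoid phi a Q) -> W' =1 W,
        forall tau,
          (fun m => \sum_(l < m)
             (lambda l / sigma l * ip (Cov_isqrt tau) (psi l)) *: phi l)
            @ \oo --> W tau &
        minimax_linear_risk K n (ellipsoid phi a Q) =
          (\sum_(0 <= l <oo) (1 / sigma l ^+ 2 * lambda l)%:E)%E].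
Proof.
have sigma_gt0 : forall l, 0 < sigma l := svd_gt0 svd.
have [kappa kappaP] := kappa_equation_exists sigma_gt0 a_gt0 a_infty Q_gt0.
have kappa_gt0 := kappa_equation_gt0 sigma_gt0 a_gt0 Q_gt0 kappaP.
have [m m0] := weight_finite_support a_gt0 a_infty kappa_gt0.
have lambda0 l : (m <= l)%N -> weight a kappa l = 0 by exact: m0.
have kappaQ := (kappa_equation_finite sigma Q lambda0).1 kappaP.
exists kappa, (filter_estimator Cov_isqrt sigma phi psi a kappa m) => lambda.
split.
- split=> // kappa' kappa'P.
  exact: (kappa_equation_unique sigma_gt0 a_gt0 a_infty Q_gt0 kappaP kappa'P).
- exact: (filter_minimax n_noise Cov_isqrtP svd phi_basis a_gt0 kappa_gt0
    lambda0 kappaQ).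
- move=> W'; exact: (minimax_unique n_noise Cov_isqrtP svd phi_basis a_gt0
    kappa_gt0 lambda0 kappaQ).
- move=> tau; exact: (filter_series Cov_isqrtP lambda0).
- rewrite (minimax_linear_riskE n_noise Cov_isqrtP svd phi_basis a_gt0
    kappa_gt0 lambda0 kappaQ) (value_series sigma lambda0).
  by apply: eq_eseriesr => l _; rewrite div1r mulrC.
Qed.
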